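(* Let $\Sigma$ be a finite nonempty alphabet, $L\subseteq\Sigma^*$ and $\kappa(L)=n\ge 1$. If $L$ is a left ideal or a suffix-closed language, then $\sigma(L)\le n^{n-1}+n-1$. This bound is tight: for $n=1$ whenever $|\Sigma|\ge 1$, for $n=2$ whenever $|\Sigma|\ge 3$, for $n=3$ whenever $|\Sigma|\ge 4$, and for $n\ge 4$ whenever $|\Sigma|\ge 5$, there is a language over $\Sigma$ of the respective type with $\kappa(L)=n$ and $\sigma(L)=n^{n-1}+n-1$. Moreover, these alphabet sizes cannot be reduced.
   Context: For $L\subseteq\Sigma^*$ and $w\in\Sigma^*$, $w^{-1}L=\{x: wx\in L\}$; $\kappa(L)$ is the number of distinct such quotients (the number of states of a minimal DFA of $L$). The syntactic congruence: $x\approx_L y$ iff for all $u,v\in\Sigma^*$, $uxv\in L\Leftrightarrow uyv\in L$; $\sigma(L)$ is the cardinality of the syntactic semigroup $\Sigma^+/\approx_L$ (equivalently, of the transition semigroup of a minimal DFA of $L$, i.e. the set of state transformations induced by nonempty words). $L$ is a left ideal if it is nonempty and $L=\Sigma^*L$; $L$ is suffix-closed if $w\in L$ implies every suffix of $w$ is in $L$. *)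

(* Defs.v *)
From mathcomp Require Import all_boot.
Set Implicit Arguments. Unset Strict Implicit. Unset Printing Implicit Defensive.

Definition lang (Sigma : finType) := seq Sigma -> Prop.

Definition quotient (Sigma : finType) (w : seq Sigma) (L : lang Sigma) : lang Sigma :=
  fun x => L (w ++ x).

Definition lang_eq (Sigma : finType) (K L : lang Sigma) : Prop :=
  forall x, K x <-> L x.

(* kappa(L) = n : L has exactly n distinct quotients, i.e. there are words
   w_0..w_{n-1} whose quotients are pairwise distinct and every quotient
   equals one of them. *)
Definition kappa_eq (Sigma : finType) (L : lang Sigma) (n : nat) : Prop :=
  exists w : 'I_n -> seq Sigma,
    (forall i j, lang_eq (quotient (w i) L) (quotient (w j) L) -> i = j) /\
    (forall u, exists i, lang_eq (quotient u L) (quotient (w i) L)).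

Definition synt_equiv (Sigma : finType) (L : lang Sigma) (x y : seq Sigma) : Prop :=
  forall u v, L (u ++ x ++ v) <-> L (u ++ y ++ v).

(* sigma(L) = m : the syntactic semigroup Sigma^+ / ~_L has exactly m
   elements, i.e. there are m nonempty words, pairwise inequivalent, such that
   every nonempty word is equivalent to one of them. *)
Definition sigma_eq (Sigma : finType) (L : lang Sigma) (m : nat) : Prop :=
  exists g : 'I_m -> seq Sigma,
    (forall i, g i != [::]) /\
    (forall i j, synt_equiv L (g i) (g j) -> i = j) /\
    (forall x, x != [::] -> exists i, synt_equiv L x (g i)).

Definition left_ideal (Sigma : finType) (L : lang Sigma) : Prop :=
  (exists w, L w) /\
  (forall w, L w <-> exists u v, w = u ++ v /\ L v).

Definition suffix_closed (Sigma : finType) (L : lang Sigma) : Prop :=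
  forall u v, L (u ++ v) -> L v.

Definition sbound (n : nat) : nat := n ^ n.-1 + n - 1.

Definition min_alpha (n : nat) : nat :=
  if n == 1 then 1 else if n == 2 then 3 else if n == 3 then 4 else 5.

(* Main.v *)
Require Import Defs.
From mathcomp Require Import all_boot.
From mathcomp Require Import fingroup perm boolp zify.

Set Implicit Arguments. Unset Strict Implicit. Unset Printing Implicit Defensive.

(** Passing to complements, only left ideals matter.  Order the [n] states of the
    minimal automaton by inclusion of the languages they accept: the initial
    state [q0] is then the bottom and every word acts monotonically.

    If no two distinct states other than [q0] are comparable, a monotone map
    moving [q0] is constant, so the semigroup lies in the set of the
    [n ^ n.-1] maps fixing [q0] and the [n - 1] other constants.  Otherwise some
    [p < q] are both distinct from [q0].  A monotone map sending [q0] to [a]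
    takes values in the up-set of [a] and keeps the images of [p] and [q]
    comparable; summing over [a] gives at most half of the sum over
    [1 <= c <= n] of [c ^ (n - 2) * (c + 1)], which is strictly below the bound.

    Hence the bound is attained exactly by the full set of maps fixing [q0]
    together with the constants.  Generating it takes a letter moving [q0], an
    injective letter (two of them if [n >= 4], as powers of a single permutation
    commute), a letter sending some other state to [q0] and, if
    [n >= 3], a non-injective letter sending no other state to [q0].  Suitable
    letters of these kinds suffice. *)

(** * Elementary inequalities between powers *)

(** Bernoulli's inequality [(1 + 1/c)^k >= 1 + k/c] with denominators cleared. *)
Lemma bernoulli_expn c k : c ^ k * (c + k) <= c * c.+1 ^ k.
Proof.
elim: k => [|k IH]; first by rewrite !expn0; lia.
rewrite !expnS; set u := c ^ k in IH *; set v := c.+1 ^ k in IH *.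
by apply: (@leq_trans (c.+1 * (u * (c + k)))); nia.
Qed.

Lemma expn_double c k : 0 < c -> c <= k -> 2 * c ^ k <= c.+1 ^ k.
Proof.
move=> c0 ck; rewrite -(leq_pmul2l c0).
by apply: leq_trans (bernoulli_expn c k); nia.
Qed.

(** The binomial expansion of [(1 + 1/m)^k] cut after its quadratic term and multiplied by
    [2 * m ^ (k + 2)]. *)
Lemma bernoulli2_expn m k :
  m ^ k * (2 * m ^ 2 + 2 * k * m + k * k.-1) <= 2 * m ^ 2 * m.+1 ^ k.
Proof.
elim: k => [|k IH]; first by rewrite !expn0; lia.
rewrite [m ^ k.+1]expnS [m.+1 ^ k.+1]expnS.
set u := m ^ k in IH *; set v := m.+1 ^ k in IH *.
have -> : 2 * m ^ 2 * (m.+1 * v) = m.+1 * (2 * m ^ 2 * v) by lia.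
apply: leq_trans (leq_mul (leqnn m.+1) IH).
have -> : m * u * (2 * m ^ 2 + 2 * k.+1 * m + k.+1 * k.+1.-1)
  = u * (m * (2 * m ^ 2 + 2 * k.+1 * m + k.+1 * k)) by rewrite /=; lia.
have -> : m.+1 * (u * (2 * m ^ 2 + 2 * k * m + k * k.-1))
  = u * (m.+1 * (2 * m ^ 2 + 2 * k * m + k * k.-1)) by lia.
by rewrite leq_mul2l -mulnn; apply/orP; right; case: k {IH v u} => [|k] /=; nia.
Qed.

(** The linear Bernoulli bound gives only the factor [1 + m/(m+1)], just short of 2. The quadratic
    term closes the gap once [m * (m - 1) >= 2 * (m + 1)], that is, from [m = 4] on. *)
Lemma expn_double_pred m : 4 <= m -> 2 * m.+1 ^ m <= m.+2 ^ m.
Proof.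
move=> m4; have := bernoulli2_expn m.+1 m.
set u := m.+1 ^ m; set v := m.+2 ^ m => H.
have m1 : 0 < 2 * m.+1 ^ 2 by rewrite muln_gt0 expn_gt0.
rewrite -(leq_pmul2l m1); apply: leq_trans H.
rewrite -mulnn.
have -> : 2 * (m.+1 * m.+1) * (2 * u) = u * (4 * (m.+1 * m.+1)) by lia.
rewrite leq_mul2l; apply/orP; right.
by case: m m4 {u v m1} => [//|m] m4 /=; nia.
Qed.

Lemma power_sum_bound m : 0 < m ->
  \sum_(c < m.+2) c.+1 ^ m * c.+2 < 2 * (m.+2 ^ m.+1 + m.+1).
Proof.
move=> m0.
(* [expn_double_pred] fails for [m] from 1 to 3; there the sums are computed. *)
have [m4|] := leqP 4 m; last first.
  by case: m m0 => [//|[|[|[|]]]] // _ _; rewrite !big_ord_recr big_ord0.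
(* Adding the next summand to the bound gives [2 * j.+1 ^ m * j.+1], and doubling a power is paid
   for by raising its base by one. *)
have tele j : j <= m -> \sum_(c < j) c.+1 ^ m * c.+2 <= j.+1 ^ m * j.
  elim: j => [|j IH] jm; first by rewrite big_ord0.
  rewrite big_ord_recr /=.
  have := IH (ltnW jm); have := expn_double (ltn0Sn j) jm.
  set u := j.+1 ^ m; set v := j.+2 ^ m; set S := \sum_(_ < _) _.
  by nia.
(* With the last two summands the bound becomes exactly [2 * m.+2 ^ m.+1]; the extra [m.+1] makes
   the inequality strict. *)
rewrite !big_ord_recr /= expnS.
have := tele _ (leqnn m); have := expn_double_pred m4.
set u := m.+1 ^ m; set v := m.+2 ^ m; set S := \sum_(_ < _) _.
by nia.
Qed.

(** * Counting monotone maps of a finite poset with a least element *)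

Section Posets.

Variables (Q : finType) (le : rel Q) (q0 : Q).
Hypothesis le_refl : reflexive le.
Hypothesis le_trans : transitive le.
Hypothesis le_anti : antisymmetric le.
Hypothesis le_bot : forall x, le q0 x.

Definition up (a : Q) : {set Q} := [set x | le a x].

Definition monotone_maps : {set {ffun Q -> Q}} :=
  [set f : {ffun Q -> Q} | [forall x, forall y, le x y ==> le (f x) (f y)]].

Lemma monotone_mapsP (f : {ffun Q -> Q}) :
  reflect (forall x y, le x y -> le (f x) (f y)) (f \in monotone_maps).
Proof.
rewrite inE; apply: (iffP forallP) => H x.
  by move=> y; have /forallP/(_ y)/implyP := H x.
by apply/forallP => y; apply/implyP; apply: H.
Qed.

(* Listing the elements along a linear extension, the i-th from the top has
   at most i elements above it. *)
Lemma sum_up_leq (phi : nat -> nat) (A : {set Q}) :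
  {homo phi : x y / x <= y} ->
  \sum_(a in A) phi #|up a :&: A| <= \sum_(c < #|A|) phi c.+1.
Proof.
move=> phi_mono; move: {2}#|A| (erefl #|A|) => n; elim: n A => [|n IH] A cA.
  by move/cards0_eq: cA => ->; rewrite big_set0.
have [a0 a0A] : exists a, a \in A by apply/set0Pn; rewrite -card_gt0 cA.
(* An element with the largest up-set is minimal in [A], so removing it does not shrink the up-sets
   of the others within [A]. *)
case: (@arg_maxnP _ a0 (mem A) (fun a => #|up a|) a0A) => m mA mmax; have {}mA : m \in A by [].
rewrite cA big_ord_recr /= (big_setD1 _ mA) /= addnC leq_add //; last first.
  by apply: phi_mono; rewrite -cA subset_leq_card // subsetIr.
have cA' : #|A :\ m| = n by move: cA; rewrite (cardsD1 m) mA => -[].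
have := IH _ cA'; rewrite cA'; apply: leq_trans.
apply: leq_sum => a; rewrite !inE => /andP[am aA].
apply: phi_mono; apply: subset_leq_card; apply/subsetP => x.
rewrite !inE => /andP[ax xA]; rewrite ax xA !andbT.
apply: contraNneq am => xm; rewrite xm in ax.
have sub : up m \subset up a.
  by apply/subsetP => y; rewrite !inE; apply: le_trans.
have /eqP eq_up : up m == up a by rewrite eqEcard sub; apply: mmax.
have : a \in up m by rewrite eq_up inE.
by rewrite inE => ma; apply/eqP/le_anti; rewrite ax ma.
Qed.

(** The set of ordered pairs and its mirror image together lie in the square of [U], and by
    antisymmetry they meet only on the diagonal. *)
Lemma card_comparable_pairs (U : {set Q}) :
  2 * #|[set xy : Q * Q | [&& xy.1 \in U, xy.2 \in U & le xy.1 xy.2]]|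
    <= #|U| * #|U|.+1.
Proof.
set A := [set xy : Q * Q | _].
pose sw (z : Q * Q) := (z.2, z.1).
have sw_inj : injective sw by move=> [x y] [x' y'] [-> ->].
have cB : #|sw @: A| = #|A| by rewrite card_imset.
rewrite mul2n -addnn -{2}cB -cardsUI mulnSr leq_add //.
  rewrite -cardsX; apply: subset_leq_card; apply/subsetP => -[x y].
  rewrite inE => /orP[|/imsetP[[x' y']]]; first by rewrite !inE => /and3P[-> ->].
  by rewrite !inE => /and3P[/= ? ? _] [-> ->]; apply/andP.
pose diag (x : Q) := (x, x).
have diag_inj : injective diag by move=> x y [].
rewrite -(card_imset _ diag_inj); apply: subset_leq_card.
apply/subsetP => -[x y]; rewrite inE => /andP[].
rewrite inE /= => /and3P[xU yU xy] /imsetP[[x' y']].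
rewrite inE /= => /and3P[_ _ yx] [ex ey]; subst x' y'.
have -> : y = x by apply: le_anti; rewrite xy yx.
by apply/imsetP; exists x.
Qed.

Lemma card_minus3 (p q : Q) : p != q0 -> q != q0 -> p != q ->
  #|Q| = 3 + #|[set: Q] :\ q0 :\ p :\ q|.
Proof.
move=> p0 qn0 pq; rewrite -cardsT (cardsD1 q0) inE (cardsD1 p) !inE p0.
by rewrite (cardsD1 q) !inE qn0 eq_sym pq !addnA.
Qed.

Lemma card_fiber (p q a x y : Q) (U : {set Q}) : p != q0 -> q != q0 -> p != q ->
  #|[set f : {ffun Q -> Q} | [&& f q0 == a, f p == x, f q == y
       & [forall z, f z \in U]]]| <= #|U| ^ (#|Q| - 3).
Proof.
move=> p0 qn0 pq.
pose F z : pred Q := if z == q0 then pred1 a else if z == p then pred1 x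
  else if z == q then pred1 y else mem U.
apply: (@leq_trans #|family F|).
  apply: subset_leq_card; apply/subsetP => f.
  rewrite inE => /and4P[/eqP f0 /eqP fp /eqP fq /forallP fU].
  apply/familyP => z; rewrite /F.
  case: eqP => [->|_]; first by rewrite f0 inE.
  case: eqP => [->|_]; first by rewrite fp inE.
  by case: eqP => [->|_]; first by rewrite fq inE.
rewrite card_family foldrE big_map big_enum /=.
rewrite (bigD1 q0) //= (bigD1 p) //= (bigD1 q) /=; last by rewrite qn0 eq_sym.
rewrite /F eqxx (negPf p0) eqxx (negPf qn0) eq_sym (negPf pq) eqxx !card1 !mul1n.
rewrite (eq_bigr (fun _ => #|U|)); last first.
  by move=> z /andP[/andP[/negPf-> /negPf->] /negPf->].
rewrite prod_nat_const leq_eqVlt; apply/orP; left; apply/eqP; congr (_ ^ _).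
rewrite (card_minus3 p0 qn0 pq) addKn; apply: eq_card => z; rewrite !inE !unfold_in andbT.
by case: (z == q0); case: (z == p); case: (z == q).
Qed.

Lemma card_monotone_nonflat (p q : Q) :
  p != q0 -> q != q0 -> p != q -> le p q -> #|monotone_maps| < sbound #|Q|.
Proof.
move=> p0 qn0 pq lepq.
have cQ : #|Q| = (#|Q| - 3).+3.
  by rewrite {1}(card_minus3 p0 qn0 pq) (card_minus3 p0 qn0 pq) addKn.
set m := #|Q| - 3 in cQ.
(* With [c] the size of the up-set of [f q0], the factor [c * c.+1] bounds twice the number of pairs
   [(f p, f q)], and [c ^ m] bounds the choices at the other points. *)
pose phi c := c ^ m.+1 * c.+1.
have phi_mono : {homo phi : x y / x <= y}.
  by move=> x y xy; rewrite leq_mul // leq_exp2r.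
suff H : 2 * #|monotone_maps| <= \sum_(a : Q) phi #|up a|.
  rewrite -(ltn_pmul2l (isT : 0 < 2)); apply: (leq_ltn_trans H).
  have := sum_up_leq setT phi_mono.
  rewrite cardsT cQ big_mkcond /=; under eq_bigr do rewrite in_setT setIT.
  move/leq_ltn_trans; apply.
  by rewrite /sbound /= -addnBA // subn1 power_sum_bound.
have -> : #|monotone_maps| = \sum_(a : Q) \sum_(xy : Q * Q)
    #|[set f in monotone_maps | (f q0 == a) && ((f p, f q) == xy)]|.
  rewrite -sum1_card (partition_big (fun f : {ffun Q -> Q} => f q0) predT) //=.
  apply: eq_bigr => a _.
  rewrite (partition_big (fun f : {ffun Q -> Q} => (f p, f q)) predT) //=.
  apply: eq_bigr => xy _; rewrite -sum1_card; apply: eq_bigl => f.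
  by rewrite inE andbA.
rewrite big_distrr; apply: leq_sum => a _.
pose P := [set xy : Q * Q | [&& xy.1 \in up a, xy.2 \in up a & le xy.1 xy.2]].
apply: (@leq_trans (2 * (#|P| * #|up a| ^ m))); last first.
  have := card_comparable_pairs (up a); rewrite -/P /phi expnS.
  set u := _ ^ m; set c := #|up a|; set e := #|P|; nia.
rewrite leq_mul2l /= -sum_nat_const [leqRHS]big_mkcond; apply: leq_sum => -[x y] _ /=.
case: ifP => xyP; last first.
  rewrite leqn0 cards_eq0; apply/eqP/setP => f; rewrite in_set0; apply/negP.
  rewrite inE => /and3P[/monotone_mapsP fm /eqP f0 /eqP[fp fq]].
  by move: xyP; rewrite !inE /= -f0 -fp -fq !fm.
apply: leq_trans (card_fiber a x y (up a) p0 qn0 pq).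
apply: subset_leq_card; apply/subsetP => f; rewrite !inE.
move=> /and3P[/forallP fm /eqP f0 /eqP[fp fq]].
rewrite f0 fp fq !eqxx /=; apply/forallP => z; rewrite inE -f0.
by have /forallP/(_ z)/implyP := fm q0; apply.
Qed.

End Posets.

(** * The extremal set of maps *)

Section IdealMaps.

Variables (Q : finType) (q0 : Q).

Definition fixing_maps : {set {ffun Q -> Q}} := [set f : {ffun Q -> Q} | f q0 == q0].
(** The constant [q0] is left out because it already fixes [q0]; this makes the union below
    disjoint. *)
Definition constant_maps : {set {ffun Q -> Q}} :=
  (fun c : Q => [ffun _ : Q => c]) @: [set~ q0].
Definition ideal_maps := fixing_maps :|: constant_maps.

Lemma ideal_mapsP (f : {ffun Q -> Q}) :
  reflect (f q0 = q0 \/ forall x, f x = f q0) (f \in ideal_maps).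
Proof.
rewrite !inE; apply: (iffP orP).
  by case=> [/eqP|/imsetP[c _ ->]]; [left | right => x; rewrite !ffunE].
case: (eqVneq (f q0) q0) => [_|n0]; first by left.
case=> [//|fc]; first by move/eqP: n0.
by right; apply/imsetP; exists (f q0); [rewrite !inE | apply/ffunP => x; rewrite ffunE].
Qed.

Lemma card_ideal_maps : #|ideal_maps| = sbound #|Q|.
Proof.
have Q0 : 0 < #|Q| by apply/card_gt0P; exists q0.
rewrite /ideal_maps cardsU disjoint_setI0 ?cards0 ?subn0; last first.
  apply/pred0P => f /=; apply/negP => /andP[]; rewrite inE => f0 /imsetP[c].
  by rewrite !inE => cn fc; move: f0; rewrite fc ffunE (negPf cn).
rewrite card_imset; last by move=> x y /ffunP/(_ q0); rewrite !ffunE.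
rewrite cardsC1 /sbound -addnBA // subn1; congr (_ + _).
(* With default value [q0], the support of [f] avoids the point [q0] exactly when [f q0 = q0]. *)
have := card_pffun_on q0 (predC1 q0) (@predT Q); rewrite cardC1 => <-.
apply: eq_card => f; rewrite inE; apply/eqP/pffun_onP => [f0|[]].
  by split=> //; apply/supportP => x; rewrite !inE negbK => /eqP->.
by move/supportP/(_ q0) => H _; apply: H; rewrite !inE eqxx.
Qed.

Lemma monotone_flat (le : rel Q) : reflexive le -> (forall x, le q0 x) ->
  (forall x y, le x y -> x != q0 -> x = y) ->
  monotone_maps le \subset ideal_maps.
Proof.
move=> le_refl le_bot flat; apply/subsetP => f /monotone_mapsP fm.
apply/ideal_mapsP; case: (eqVneq (f q0) q0) => [|n0]; [by left | right=> x].
by apply/esym; apply: flat n0; apply: fm.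
Qed.

(** A comparable pair away from [q0] makes the bound strict. Equality therefore forces the flat
    order, where [T] lies in [ideal_maps q0] and has the same cardinality. *)
Lemma monotone_semigroup (le : rel Q) (T : {set {ffun Q -> Q}}) :
  reflexive le -> transitive le -> antisymmetric le -> (forall x, le q0 x) ->
  T \subset monotone_maps le ->
  #|T| <= sbound #|Q| /\ (#|T| = sbound #|Q| -> T = ideal_maps).
Proof.
move=> le_refl le_trans le_anti le_bot TM.
have cT := subset_leq_card TM.
have [/existsP[p /existsP[q /and3P[p0 lepq pq]]]|flat] :=
    boolP [exists p, exists q, [&& p != q0, le p q & p != q]].
  have qn0 : q != q0.
    apply: contraNneq p0 => eq0; apply/eqP/le_anti.
    by rewrite le_bot -{1}eq0 lepq.
  have := card_monotone_nonflat le_refl le_trans le_anti le_bot p0 qn0 pq lepq.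
  by move/(leq_ltn_trans cT) => lt; split; [exact: ltnW | move=> e; rewrite e ltnn in lt].
have TI : T \subset ideal_maps.
  apply: (subset_trans TM); apply: monotone_flat => // x y lexy x0.
  apply/eqP; apply: contraNT flat => xy.
  by apply/existsP; exists x; apply/existsP; exists y; rewrite x0 lexy.
rewrite -card_ideal_maps; split; first exact: subset_leq_card.
by move=> e; apply/eqP; rewrite eqEcard TI e leqnn.
Qed.

End IdealMaps.

(** * Letters forced by a full transition semigroup *)

Section Transitions.

Variables (Sigma Q : finType) (delta : Sigma -> {ffun Q -> Q}).

Definition run (q : Q) (w : seq Sigma) : Q := foldl (fun p a => delta a p) q w.

Definition trans (w : seq Sigma) : {ffun Q -> Q} := [ffun q => run q w].

Definition transition_semigroup : {set {ffun Q -> Q}} :=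
  [set f | `[< exists2 w, w != [::] & trans w = f >]].

Lemma run_cat q u v : run q (u ++ v) = run (run q u) v.
Proof. exact: foldl_cat. Qed.

Lemma transition_semigroupP f :
  reflect (exists2 w, w != [::] & trans w = f) (f \in transition_semigroup).
Proof. by rewrite inE; apply: asboolP. Qed.

Lemma trans_in w : w != [::] -> trans w \in transition_semigroup.
Proof. by move=> w0; apply/transition_semigroupP; exists w. Qed.

Lemma letter_in a : delta a \in transition_semigroup.
Proof.
apply/transition_semigroupP; exists [:: a] => //.
by apply/ffunP => q; rewrite ffunE.
Qed.

(** The first letter is injective, hence onto by finiteness, so injectivity passes to the rest of
    the word. *)
Lemma run_inj_letters w : injective (run^~ w) ->
  forall a, a \in w -> injective (delta a).
Proof.
elim: w => [//|b w IH] inj a.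
have injb : injective (delta b) by move=> x y e; apply: inj; rewrite /= e.
rewrite inE => /orP[/eqP->//|]; apply: IH => x y.
by rewrite -(f_invF injb x) -(f_invF injb y) => /inj ->.
Qed.

Lemma first_noninj_letter w : ~ injective (run^~ w) ->
  exists u a v, [/\ w = u ++ a :: v, injective (run^~ u) & ~ injective (delta a)].
Proof.
elim: w => [|a w IH] ninj; first by exfalso; apply: ninj => x y.
have [inja|ninja] := pselect (injective (delta a)); last first.
  by exists [::], a, w; split=> // x y.
have [|u [b [v [-> injv ninjb]]]] := IH.
  by move=> inj; apply: ninj => x y /inj/inja.
by exists (a :: u), b, v; split=> // x y /injv/inja.
Qed.

Variable q0 : Q.
Hypothesis full : transition_semigroup = ideal_maps q0.

Lemma word_of (f : {ffun Q -> Q}) : f \in ideal_maps q0 ->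
  exists2 w, w != [::] & forall q, run q w = f q.
Proof.
rewrite -full => /transition_semigroupP[w w0 <-].
by exists w => // q; rewrite ffunE.
Qed.

Lemma fixing_word (f : {ffun Q -> Q}) : f q0 = q0 ->
  exists2 w, w != [::] & forall q, run q w = f q.
Proof. by move=> f0; apply: word_of; apply/ideal_mapsP; left. Qed.

Lemma run_ideal w : run q0 w = q0 \/ forall x, run x w = run q0 w.
Proof.
case: (eqVneq w [::]) => [->|w0]; first by left.
have := trans_in w0; rewrite full => /ideal_mapsP; rewrite ffunE.
by case=> [|H]; [left | right => x; have := H x; rewrite ffunE].
Qed.

Lemma letter_ideal a : delta a q0 = q0 \/ forall x, delta a x = delta a q0.
Proof. exact: (run_ideal [:: a]). Qed.

Lemma run_inj_fixes p w : p != q0 -> injective (run^~ w) -> run q0 w = q0.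
Proof.
move=> p0 inj; case: (run_ideal w) => // /(_ p) /inj e.
by rewrite e eqxx in p0.
Qed.

Lemma exists_moving_letter p : p != q0 -> exists a, delta a q0 <> q0.
Proof.
move=> p0; apply: contrapT => none.
have [w _ wE] : exists2 w, w != [::] & forall q, run q w = [ffun _ => p] q.
  by apply: word_of; apply/ideal_mapsP; right => x; rewrite !ffunE.
suff : run q0 w = q0 by rewrite wE ffunE => e; rewrite e eqxx in p0.
elim: w {wE} => //= a w; suff -> : delta a q0 = q0 by [].
by apply: contrapT => ne; apply: none; exists a.
Qed.

(** Along a word inducing the constant [q0], the path from [p] must enter [q0]; the letter of first
    entry is the one sought. *)
Lemma exists_partial_letter p : p != q0 ->
  exists a x, [/\ delta a q0 = q0, x != q0 & delta a x = q0].
Proof.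
move=> p0; have [w _ wE] : exists2 w, w != [::] & forall q, run q w = [ffun _ => q0] q.
  by apply: fixing_word; rewrite ffunE.
have {wE} : run p w = q0 by rewrite wE ffunE.
elim: w p p0 => [|a w IH] p p0 /=; first by move=> e; rewrite e eqxx in p0.
case: (eqVneq (delta a p) q0) => [e _|n]; last exact: IH.
by case: (letter_ideal a) => [f|/(_ p)]; [exists a, p | rewrite e => f; exists a, p].
Qed.

Lemma exists_injective_letter p : p != q0 ->
  exists2 a, delta a q0 = q0 & injective (delta a).
Proof.
move=> p0; have [w w0 wE] : exists2 w, w != [::] & forall q, run q w = [ffun x => x] q.
  by apply: fixing_word; rewrite ffunE.
have inj : injective (run^~ w) by move=> x y; rewrite !wE !ffunE.
case: w w0 {wE} inj => [//|a w] _ /run_inj_letters/(_ a (mem_head _ _)) inja.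
by exists a => //; apply: (@run_inj_fixes p [:: a]).
Qed.

Lemma exists_merging_letter x y : x != q0 -> y != q0 -> x != y ->
  exists a, [/\ delta a q0 = q0, ~ injective (delta a)
              & forall z, delta a z = q0 -> z = q0].
Proof.
move=> x0 y0 xy.
pose f : {ffun Q -> Q} := [ffun z => if z == x then y else z].
have f0 : f q0 = q0 by rewrite ffunE eq_sym (negPf x0).
have fn0 z : f z = q0 -> z = q0.
  by rewrite ffunE; case: eqP => // _ e; rewrite e eqxx in y0.
have [w _ wE] := fixing_word f0.
(* Cut a word for the collapse [f] at its first non-injective letter [a]. If [a] were constant, [f]
   would be too, although [f y] differs from [q0]. *)
have [|u [a [v [eq_w inju ninja]]]] := @first_noninj_letter w.
  by move/(_ x y); rewrite !wE !ffunE eqxx if_same => /(_ erefl) e; rewrite e eqxx in xy.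
have wE' z : run (delta a (run z u)) v = f z by rewrite -wE eq_w run_cat.
have a0 : delta a q0 = q0.
  case: (letter_ideal a) => // ac.
  have : f y = f q0 by rewrite -!wE' ac [in RHS]ac.
  by rewrite f0 => /fn0 e; rewrite e eqxx in y0.
exists a; split=> // z az.
have u0 : run q0 u = q0 by apply: run_inj_fixes inju; exact: x0.
have v0 : run q0 v = q0 by rewrite -{2}f0 -wE' u0 a0.
(* The prefix [u] is a bijection fixing [q0]. If [a] sends [z] to [q0], then [f] sends its preimage
   [t] to [q0], whence [t = q0]. *)
rewrite -(f_invF inju z); set t := invF _ _.
suff -> : t = q0 by [].
by apply: fn0; rewrite -wE' (f_invF inju z) az.
Qed.

Lemma exists_two_injective_letters x y z :
  x != q0 -> y != q0 -> z != q0 -> x != y -> x != z -> y != z ->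
  exists a b, [/\ a != b, delta a q0 = q0, delta b q0 = q0,
                  injective (delta a) & injective (delta b)].
Proof.
move=> x0 y0 z0 xy xz yz.
have [b b0 injb] := exists_injective_letter x0.
apply: contrapT => none.
have uniq_b a : injective (delta a) -> a = b.
  move=> inja; apply/eqP; apply: contrapT => /negP ab; apply: none.
  by exists a, b; split=> //; apply: (@run_inj_fixes x [:: a]).
(* Every letter of a word inducing a permutation is injective, hence equal to [b]; the exponent is
   the length of the word. *)
have powers (s : {perm Q}) : s q0 = q0 -> exists k, forall q, s q = iter k (delta b) q.
  move=> s0; have [|w _ wE] := @fixing_word [ffun q => s q]; first by rewrite ffunE.
  have inj : injective (run^~ w) by move=> q r; rewrite !wE !ffunE => /perm_inj.
  exists (size w) => q; have <- : run q w = s q by rewrite wE ffunE.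
  move/run_inj_letters: inj; elim: w q {wE} => //= a w IH q H.
  rewrite (uniq_b a) ?IH -?iterSr //; last by apply: H; rewrite mem_head.
  by move=> c cw; apply: H; rewrite inE cw orbT.
have [|k kE] := powers (tperm x y); first by rewrite tpermD.
have [|l lE] := powers (tperm y z); first by rewrite tpermD.
(* Commutation is contradicted at [x]: the left side is [z], the right side is [y]. *)
have : tperm y z (tperm x y x) = tperm x y (tperm y z x).
  by rewrite !kE !lE -!iterD addnC.
have -> : tperm y z x = x by rewrite tpermD // eq_sym.
rewrite !tpermL => e.
by rewrite e eqxx in yz.
Qed.

(** The kinds of letters exclude one another: they are told apart by moving [q0], by injectivity,
    and by sending another state to [q0]. *)
Lemma min_alpha_le : 1 < #|Q| -> min_alpha #|Q| <= #|Sigma|.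
Proof.
move=> Q1; have cQ : #|[set~ q0]| = #|Q|.-1 by rewrite cardsC1.
have [p p0] : exists p, p != q0.
  have /card_gt0P[p] : 0 < #|[set~ q0]| by rewrite cQ; lia.
  by rewrite !inE; exists p.
have [a a0] := exists_moving_letter p0.
have [b b0 injb] := exists_injective_letter p0.
have [c [x [c0 x0 cx]]] := exists_partial_letter p0.
have ninjc : ~ injective (delta c).
  by move/(_ x q0); rewrite cx c0 => /(_ erefl) e; rewrite e eqxx in x0.
have card_le (s : seq Sigma) : uniq s -> size s <= #|Sigma|.
  by move/card_uniqP <-; apply: max_card.
have ab : a != b by apply/eqP => e; rewrite e in a0.
have ac : a != c by apply/eqP => e; rewrite e in a0.
have bc : b != c by apply/eqP => e; rewrite e in injb.
rewrite /min_alpha; case: eqP => [|_]; first by lia.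
case: eqP => [_|n2]; first by apply: (card_le [:: a; b; c]); rewrite /= !inE !negb_or ab ac bc.
have /card_gt1P[y [z []]] : 1 < #|[set~ q0]| by rewrite cQ; lia.
rewrite !inE => y0 z0 yz.
have [d [d0 ninjd dn0]] := exists_merging_letter y0 z0 yz.
have ad : a != d by apply/eqP => e; rewrite e in a0.
have bd : b != d by apply/eqP => e; rewrite e in injb.
have cd : c != d by apply: contra_neqN x0 => /eqP e; apply: dn0; rewrite -e.
case: eqP => [_|n3].
  by apply: (card_le [:: a; b; c; d]); rewrite /= !inE !negb_or ab ac bc ad bd cd.
have {y z y0 z0 yz} /card_gt2P[y [z [t []]]] : 2 < #|[set~ q0]| by rewrite cQ; lia.
rewrite !inE => -[y0 z0 t0] [yz zt ty].
have [|b1 [b2 [b12 b10 b20 inj1 inj2]]] := exists_two_injective_letters y0 z0 t0 yz _ zt.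
  by rewrite eq_sym.
have ab1 : a != b1 by apply/eqP => e; rewrite e in a0.
have ab2 : a != b2 by apply/eqP => e; rewrite e in a0.
have b1c : b1 != c by apply/eqP => e; rewrite e in inj1.
have b2c : b2 != c by apply/eqP => e; rewrite e in inj2.
have b1d : b1 != d by apply/eqP => e; rewrite e in inj1.
have b2d : b2 != d by apply/eqP => e; rewrite e in inj2.
apply: (card_le [:: a; b1; b2; c; d]).
by rewrite /= !inE !negb_or ab1 ab2 ac ad b12 b1c b1d b2c b2d cd.
Qed.

End Transitions.

(** * Quotients, syntactic semigroup and complements through minimal automata *)

Section MinimalAutomata.

Variable Sigma : finType.
Implicit Type L : lang Sigma.

Definition minimal_dfa (Q : finType) L (delta : Sigma -> {ffun Q -> Q}) (q0 : Q)
    (F : Q -> Prop) : Prop :=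
  [/\ forall w, L w <-> F (run delta q0 w),
      forall q, exists w, run delta q0 w = q
    & forall p q, (forall w, F (run delta p w) <-> F (run delta q w)) -> p = q].

Lemma kappa_minimal_dfa L n : kappa_eq L n ->
  exists (delta : Sigma -> {ffun 'I_n -> 'I_n}) q0 F, minimal_dfa L delta q0 F.
Proof.
case=> w [w_inj w_surj].
(* [st u] is the index of the quotient by [u]; the automaton built below is the quotient automaton
   on these indices. *)
have [st stE] := choice w_surj.
have st_eq u v : lang_eq (quotient u L) (quotient v L) -> st u = st v.
  move=> uv; apply: w_inj => x; split=> H.
    by apply/(stE v)/uv/(stE u).
  by apply/(stE u)/uv/(stE v).
have stK i : st (w i) = i by apply: w_inj => x; split=> H; apply/(stE (w i)).
pose delta a : {ffun 'I_n -> 'I_n} := [ffun i => st (rcons (w i) a)].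
have runE u x : run delta (st u) x = st (u ++ x).
  elim: x u => [|a x IH] u /=; first by rewrite cats0.
  rewrite -cat_rcons -IH ffunE; congr (run _ _ _); apply: st_eq => y.
  by rewrite /quotient !cat_rcons; split=> /(stE u).
exists delta, (st [::]), (fun i => L (w i)).
have accE x : L x <-> L (w (st x)).
  by have := stE x [::]; rewrite /quotient !cats0.
split=> [x|i|i j ij]; first by rewrite runE.
  by exists (w i); rewrite runE stK.
apply: w_inj => x; rewrite /quotient.
have E k : L (w k ++ x) <-> L (w (run delta k x)).
  by rewrite -{2}[k]stK runE.
by split=> /E/ij/E.
Qed.

Lemma minimal_dfa_kappa n L (delta : Sigma -> {ffun 'I_n -> 'I_n}) q0 F :
  minimal_dfa L delta q0 F -> kappa_eq L n.
Proof.
case=> acc reach sep; have [w wE] := choice reach.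
have E i x : L (w i ++ x) <-> F (run delta i x).
  by have := acc (w i ++ x); rewrite run_cat wE.
exists w; split=> [i j ij|u].
  by apply: sep => x; split=> /E/ij/E.
exists (run delta q0 u) => x; rewrite /quotient.
by split=> [/acc|/E]; rewrite ?run_cat => H; [apply/E | apply/acc; rewrite run_cat].
Qed.

Section Fixed.

Variables (Q : finType) (L : lang Sigma) (delta : Sigma -> {ffun Q -> Q}).
Variables (q0 : Q) (F : Q -> Prop).
Hypothesis dfa : minimal_dfa L delta q0 F.

(** By reachability the left contexts run through all states; by separation the right contexts
    distinguish their images. *)
Lemma synt_equivE x y : synt_equiv L x y <-> trans delta x = trans delta y.
Proof.
case: dfa => acc reach sep; split=> [xy|xy u v].
  apply/ffunP => q; rewrite !ffunE; have [u <-] := reach q.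
  by apply: sep => v; rewrite -!run_cat; split=> /acc/xy/acc.
have E q : run delta q x = run delta q y by have /ffunP/(_ q) := xy; rewrite !ffunE.
by split=> /acc H; apply/acc; move: H; rewrite !run_cat E.
Qed.

Lemma sigma_eqE m : sigma_eq L m <-> m = #|transition_semigroup delta|.
Proof.
split=> [[g [g0 [g_inj g_surj]]]|->].
  have t_inj : injective (fun i => trans delta (g i)).
    by move=> i j /synt_equivE/g_inj.
  rewrite -[LHS]card_ord -cardsT -(card_imset _ t_inj); apply: eq_card => f.
  apply/imsetP/transition_semigroupP => [[i _ ->]|[x x0 <-]]; first by exists (g i).
  by have [i /synt_equivE] := g_surj x x0; exists i.
set T := transition_semigroup delta.
have /choice[g gP] (i : 'I_#|T|) :
    exists w, w != [::] /\ trans delta w = enum_val i.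
  by have /transition_semigroupP[w w0 wE] := enum_valP i; exists w.
exists g; split=> [i|]; first by case: (gP i).
split=> [i j /synt_equivE|x x0].
  by case: (gP i) => _ ->; case: (gP j) => _ -> /enum_val_inj.
pose i := enum_rank_in (trans_in delta x0) (trans delta x).
exists i; apply/synt_equivE; have [_ ->] := gP i.
by rewrite enum_rankK_in // trans_in.
Qed.

Lemma left_closed_semigroup : (forall u v, L v -> L (u ++ v)) ->
  #|transition_semigroup delta| <= sbound #|Q| /\
  (#|transition_semigroup delta| = sbound #|Q| ->
   transition_semigroup delta = ideal_maps q0).
Proof.
case: dfa => acc reach sep left_closed.
pose le p q := `[< forall w, F (run delta p w) -> F (run delta q w) >].
apply: (@monotone_semigroup _ _ le).
- by move=> p; apply/asboolP.
- by move=> q p r /asboolP pq /asboolP qr; apply/asboolP => w /pq/qr.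
- move=> p q /andP[/asboolP pq /asboolP qp].
  by apply: sep => w; split=> [/pq|/qp].
(* A state reached by [u] accepts the quotient of [L] by [u], which contains [L] by left closure. *)
- move=> q; apply/asboolP => w /acc Lw; have [u <-] := reach q.
  by rewrite -run_cat; apply/acc; apply: left_closed.
apply/subsetP => f /transition_semigroupP[w _ <-].
apply/monotone_mapsP => p q /asboolP pq; apply/asboolP => v.
by rewrite !ffunE -!run_cat => /pq.
Qed.

End Fixed.

Lemma left_ideal_closed L : left_ideal L -> forall u v, L v -> L (u ++ v).
Proof. by case=> _ LE u v Lv; apply/LE; exists u, v. Qed.

(** Closure under prepending words is the property shared by left ideals and complements of
    suffix-closed languages; such a complement may be empty, hence not a left ideal. *)
Lemma left_closed_bounds L n : kappa_eq L n -> (forall u v, L v -> L (u ++ v)) ->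
  (exists m, sigma_eq L m /\ m <= sbound n) /\
  (1 < n -> sigma_eq L (sbound n) -> min_alpha n <= #|Sigma|).
Proof.
move=> /kappa_minimal_dfa[delta [q0 [F dfa]]] /(left_closed_semigroup dfa).
rewrite card_ord => -[bound extremal]; split.
  by exists #|transition_semigroup delta|; split=> //; apply/(sigma_eqE dfa).
move=> n1 /(sigma_eqE dfa)/esym/extremal full.
by have := min_alpha_le full; rewrite card_ord; apply.
Qed.

Definition complement L : lang Sigma := fun w => ~ L w.

Lemma iff_complement (A B : Prop) : (~ A <-> ~ B) <-> (A <-> B).
Proof. have := EM A; have := EM B; tauto. Qed.

Lemma kappa_complement L n : kappa_eq L n -> kappa_eq (complement L) n.
Proof.
case=> w [w_inj w_surj]; exists w; split=> [i j ij|u].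
  by apply: w_inj => x; apply/iff_complement/ij.
by have [i uE] := w_surj u; exists i => x; apply/iff_complement/uE.
Qed.

Lemma sigma_complement L m : sigma_eq (complement L) m <-> sigma_eq L m.
Proof.
have E x y : synt_equiv (complement L) x y <-> synt_equiv L x y.
  by split=> xy u v; apply/iff_complement/xy.
split=> -[g [g0 [g_inj g_surj]]]; exists g; split=> //; split=> [i j /E/g_inj //|x x0].
  by have [i /E] := g_surj x x0; exists i.
by have [i /E] := g_surj x x0; exists i.
Qed.

Lemma suffix_closed_complement L : suffix_closed L ->
  forall u v, complement L v -> complement L (u ++ v).
Proof. by move=> sc u v nv /sc. Qed.

End MinimalAutomata.

(** * Generating all maps that fix a point *)

Section Generation.

Variable Q : finType.
Implicit Types (f g : {ffun Q -> Q}) (s : {perm Q}).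

(** First [f], then [g]: the order of concatenated words and of the product of permutations. *)
Definition comp_map f g : {ffun Q -> Q} := [ffun x => g (f x)].
Definition perm_map s : {ffun Q -> Q} := [ffun x => s x].
Definition id_map : {ffun Q -> Q} := [ffun x => x].
Definition const_map (c : Q) : {ffun Q -> Q} := [ffun _ => c].
Definition collapse (x y : Q) : {ffun Q -> Q} := [ffun z => if z == x then y else z].

Lemma ideal_maps_comp q0 f g :
  f \in ideal_maps q0 -> g \in ideal_maps q0 -> comp_map f g \in ideal_maps q0.
Proof.
move=> /ideal_mapsP fI /ideal_mapsP gI; apply/ideal_mapsP; rewrite !ffunE.
case: fI => [f0|fc]; last by right=> x; rewrite ffunE fc.
by case: gI => [g0|gc]; [left; rewrite f0 | right=> x; rewrite ffunE gc [in RHS]gc].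
Qed.

Variables (G : {set {ffun Q -> Q}}) (q0 : Q).
Hypothesis G_comp : forall f g, f \in G -> g \in G -> comp_map f g \in G.
Hypothesis G_id : id_map \in G.

(* Induction on the number of moved points: a moved point outside the image is
   made fixed by splitting off a collapse; if there is none then f is a
   permutation and a transposition is split off. *)
Lemma fixing_generated :
  (forall x y, x != q0 -> y != q0 -> perm_map (tperm x y) \in G) ->
  (forall x y, x != q0 -> collapse x y \in G) ->
  forall f, f q0 = q0 -> f \in G.
Proof.
move=> G_tperm G_collapse f; move: {2}#|_| (leqnn #|[set x | f x != x]|) => n.
elim: n f => [|n IH] f fn f0.
  suff -> : f = id_map by [].
  apply/ffunP => x; rewrite ffunE; apply/eqP.
  have : x \notin [set x | f x != x].
    by move: fn; rewrite leqn0 cards_eq0 => /eqP->; rewrite inE.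
  by rewrite inE negbK.
have [/existsP[x /andP[fx xim]]|perm_f] :=
    boolP [exists x, (f x != x) && (x \notin codom f)].
  have x0 : x != q0 by apply: contraNneq fx => ->; rewrite f0.
  pose f' : {ffun Q -> Q} := [ffun z => if z == x then x else f z].
  have -> : f = comp_map f' (collapse x (f x)).
    apply/ffunP => z; rewrite !ffunE; case: (eqVneq z x) => [->|_].
      by rewrite eqxx.
    by case: eqP => // e; move: xim; rewrite -e codom_f.
  apply: G_comp (G_collapse _ _ x0); apply: IH; last first.
    by rewrite ffunE eq_sym (negPf x0).
  rewrite -ltnS; apply: leq_trans fn; apply: proper_card; apply/properP; split.
    by apply/subsetP => z; rewrite !inE ffunE; case: (eqVneq z x) => [->|//]; rewrite eqxx.
  by exists x; rewrite !inE // ffunE !eqxx.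
have [/existsP[x fx]|] := boolP [exists x, f x != x]; last first.
  rewrite negb_exists => /forallP fid; suff -> : f = id_map by [].
  by apply/ffunP => x; rewrite ffunE; apply/eqP; have := fid x; rewrite negbK.
(* Fixed points are their own images and all moved points now lie in the image, so [f] is onto and
   hence injective. *)
have f_inj : injective f.
  have surj y : y \in codom f.
    apply: contraNT perm_f => yim; apply/existsP; exists y; rewrite yim andbT.
    by apply: contraNneq yim => <-; apply: codom_f.
  suff /image_injP inj : #|image f Q| == #|Q| by move=> y z; apply: inj.
  by apply/eqP/eq_card => y; rewrite surj.
have x0 : x != q0 by apply: contraNneq fx => ->; rewrite f0.
have fx0 : f x != q0 by apply: contra_neq x0 => e; apply: f_inj; rewrite e f0.
pose f' := comp_map f (perm_map (tperm x (f x))).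
have -> : f = comp_map f' (perm_map (tperm x (f x))).
  by apply/ffunP => z; rewrite !ffunE tpermK.
apply: G_comp (G_tperm _ _ x0 fx0); apply: IH; last first.
  by rewrite !ffunE f0 tpermD.
rewrite -ltnS; apply: leq_trans fn; apply: proper_card; apply/properP; split.
  apply/subsetP => z; rewrite !inE !ffunE; apply: contraNneq => fz.
  rewrite fz tpermD //; first by apply: contra_neq fx => ->.
  by apply: contra_neq fx => e; apply: f_inj; rewrite e.
by exists x; rewrite !inE // !ffunE tpermR eqxx.
Qed.

Definition perms_in : {set {perm Q}} := [set s | perm_map s \in G].

Lemma perms_in_group : group_set perms_in.
Proof.
apply/group_setP; split=> [|s t].
  by rewrite inE; suff -> : perm_map 1 = id_map by []; apply/ffunP => x; rewrite !ffunE perm1.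
rewrite !inE => sG tG; suff -> : perm_map (s * t) = comp_map (perm_map s) (perm_map t).
  exact: G_comp.
by apply/ffunP => x; rewrite !ffunE permM.
Qed.

Canonical perms_group := Group perms_in_group.

Lemma collapse_conj s x y :
  s \in perms_in -> collapse x y \in G -> collapse (s x) (s y) \in G.
Proof.
move=> sH xyG; have sVH : (s^-1)%g \in perms_in by rewrite groupV.
suff -> : collapse (s x) (s y) =
    comp_map (perm_map s^-1) (comp_map (collapse x y) (perm_map s)).
  by rewrite !inE in sH sVH; do 2 apply: (G_comp _ _) => //.
apply/ffunP => z; rewrite !ffunE; have [->|n] := eqVneq z (s x).
  by rewrite permK eqxx.
by case: eqP => [e|_]; [move: n; rewrite -e permKV eqxx | rewrite permKV].
Qed.

End Generation.

(** * Explicit generators of the extremal semigroup *)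

Section Witness.

Variable k : nat.
Notation Q := 'I_k.+2.

Definition st (i : nat) : Q := inord i.

Lemma val_st i : i < k.+2 -> st i = i :> nat.
Proof. exact: inordK. Qed.

(** The cycle [1 -> 2 -> ... -> k+1 -> 1], fixing 0. *)
Definition shift_fun (i : Q) : Q :=
  st (if i == 0 :> nat then 0 else if i == k.+1 :> nat then 1 else i.+1).

Lemma shift_funE (i : Q) : shift_fun i =
  (if i == 0 :> nat then 0 else if i == k.+1 :> nat then 1 else i.+1) :> nat.
Proof. by rewrite val_st //; have := ltn_ord i; do ![case: eqP => ?]; lia. Qed.

Lemma shift_fun_inj : injective shift_fun.
Proof.
move=> i j /(congr1 (@nat_of_ord _)); rewrite !shift_funE => e; apply: val_inj => /=; move: e.
by have := ltn_ord i; have := ltn_ord j; do ![case: eqP => ?]; lia.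
Qed.

Definition shift : {perm Q} := perm shift_fun_inj.

(** For [k = 0] the identity serves as the injective letter; for [k = 1] the cycle equals the
    transposition of 1 and 2 and would repeat it. *)
Definition gens : seq {ffun Q -> Q} :=
  [:: collapse (st 1) ord0, const_map (st 1) &
   if k == 0 then [:: id_map Q] else
   [:: perm_map (tperm (st 1) (st 2)), collapse (st 1) (st 2) &
    if k == 1 then [::] else [:: perm_map shift]]].

Lemma size_gens : size gens = min_alpha k.+2.
Proof. by rewrite /gens /min_alpha !eqSS; case: (k == 0); case: (k == 1). Qed.

Lemma st_neq0 i : 0 < i -> i < k.+2 -> st i != ord0.
Proof. by move=> i0 ik; rewrite -val_eqE /= val_st // -lt0n. Qed.

Lemma gens_ideal f : f \in gens -> f \in ideal_maps (ord0 : Q).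
Proof.
have n10 : st 1 != ord0 by apply: st_neq0.
move=> fg; apply/ideal_mapsP; move: fg; rewrite !inE => /orP[/eqP->|/orP[/eqP->|]].
- by left; rewrite ffunE eq_sym (negPf n10).
- by right=> x; rewrite !ffunE.
case: eqP => [_|/eqP k0].
  by rewrite inE => /eqP->; left; rewrite ffunE.
have n20 : st 2 != ord0 by apply: st_neq0; lia.
rewrite !inE => /orP[/eqP->|/orP[/eqP->|]].
- by left; rewrite ffunE tpermD.
- by left; rewrite ffunE eq_sym (negPf n10).
case: ifP => // _; rewrite inE => /eqP->; left.
by rewrite ffunE permE; apply: val_inj; rewrite /= shift_funE.
Qed.

Section Generated.

Variable G : {set {ffun Q -> Q}}.
Hypothesis G_comp : forall f g, f \in G -> g \in G -> comp_map f g \in G.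
Hypothesis G_gens : forall f, f \in gens -> f \in G.

Lemma gens_id : id_map Q \in G.
Proof.
have [k0|k0] := boolP (k == 0); first by apply: G_gens; rewrite /gens k0 !inE eqxx !orbT.
have tG : perm_map (tperm (st 1) (st 2)) \in G.
  by apply: G_gens; rewrite /gens (negPf k0) !inE eqxx !orbT.
suff -> : id_map Q = comp_map (perm_map (tperm (st 1) (st 2))) (perm_map (tperm (st 1) (st 2))).
  exact: G_comp.
by apply/ffunP => x; rewrite !ffunE tpermK.
Qed.

Let H := perms_group G_comp gens_id.

Lemma tperm12_in : 0 < k -> tperm (st 1) (st 2) \in H.
Proof.
move=> k0; rewrite inE; apply: G_gens.
by rewrite /gens gtn_eqF // !inE eqxx !orbT.
Qed.

Lemma shift_in : 0 < k -> shift \in H.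
Proof.
move=> k0; have [k1|k1] := eqVneq k 1; last first.
  by rewrite inE; apply: G_gens; rewrite /gens gtn_eqF // (negPf k1) !inE eqxx !orbT.
suff -> : shift = tperm (st 1) (st 2) by apply: tperm12_in.
apply/permP => i; rewrite permE; apply: val_inj; rewrite /= shift_funE.
have v1 : st 1 = 1 :> nat by apply: val_st.
have v2 : st 2 = 2 :> nat by apply: val_st; lia.
have := ltn_ord i.
case: tpermP => [->|->|/eqP] ; rewrite ?v1 ?v2 /=.
- by do ![case: eqP => ?]; lia.
- by do ![case: eqP => ?]; lia.
rewrite -val_eqE /= v1 => /eqP i1 /eqP; rewrite -val_eqE /= v2 => /eqP i2.
by do ![case: eqP => ?]; lia.
Qed.

Lemma shift_st i : i < k -> shift (st i.+1) = st i.+2.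
Proof.
move=> ik; rewrite permE; apply: val_inj; rewrite /= shift_funE !val_st; try lia.
by do ![case: eqP => ?]; lia.
Qed.

(** Conjugation by the cycle carries each adjacent transposition to the next. *)
Lemma tperm_adjacent_in i : i < k -> tperm (st i.+1) (st i.+2) \in H.
Proof.
elim: i => [|i IH] ik; first exact: tperm12_in.
have k0 : 0 < k by lia.
by have := groupJ (IH (ltnW ik)) (shift_in k0); rewrite tpermJ !shift_st //; lia.
Qed.

Lemma st_eq i j : i < k.+2 -> j < k.+2 -> (st i == st j) = (i == j).
Proof. by move=> ik jk; rewrite -val_eqE /= !val_st. Qed.

Lemma tperm1_in i : 0 < i -> i < k.+2 -> tperm (st 1) (st i) \in H.
Proof.
case: i => [//|[|i]] _; first by rewrite tperm1 group1.
elim: i => [|i IH] ik; first by apply: tperm12_in; lia.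
have /IH iH : i.+2 < k.+2 by lia.
have ik' : i.+1 < k by lia.
have := groupJ iH (tperm_adjacent_in ik'); rewrite tpermJ tpermL tpermD //.
  by rewrite st_eq //; lia.
by rewrite st_eq //; lia.
Qed.

Lemma tperm_in (x y : Q) : x != ord0 -> y != ord0 -> tperm x y \in H.
Proof.
have one (z : Q) : z != ord0 -> tperm (st 1) z \in H.
  rewrite -[z]inord_val -val_eqE /= inordK // -lt0n => z0.
  by apply: tperm1_in.
move=> x0 y0; have [->|y1] := eqVneq y (st 1); first by rewrite tpermC one.
have [->|xy] := eqVneq y x; first by rewrite tperm1 group1.
have := groupJ (one y y0) (one x x0).
by rewrite tpermJ tpermL tpermD // eq_sym.
Qed.

Lemma collapse_in (x y : Q) : x != ord0 -> collapse x y \in G.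
Proof.
have conj s a b : s \in H -> collapse a b \in G -> collapse (s a) (s b) \in G.
  by apply: collapse_conj => //; apply: gens_id.
have n10 : st 1 != ord0 by apply: st_neq0.
move=> x0; have [->|y0] := eqVneq y ord0.
  have -> : collapse x ord0 = collapse (tperm (st 1) x (st 1)) (tperm (st 1) x ord0).
    by rewrite tpermL tpermD.
  apply: conj; first exact: tperm_in.
  by apply: G_gens; rewrite /gens !inE eqxx.
have [<-|xy] := eqVneq x y.
  suff -> : collapse x x = id_map Q by apply: gens_id.
  by apply/ffunP => z; rewrite !ffunE; case: eqP.
have k0 : 0 < k.
  move: x0 y0 xy; rewrite -!val_eqE /=.
  by have := ltn_ord x; have := ltn_ord y; lia.
have n20 : st 2 != ord0 by apply: st_neq0; lia.
have n12 : st 1 != st 2 by rewrite st_eq //; lia.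
set t := tperm (st 1) x (st 2).
have t0 : t != ord0 by rewrite /t; case: tpermP.
have tx : t != x by rewrite -(tpermL (st 1) x) (inj_eq perm_inj) eq_sym.
(* The first factor sends 1 to [x] and 2 to [t]; the second sends [t] to [y] and leaves [x] alone.
   So [s] conjugates the generator [collapse (st 1) (st 2)] to [collapse x y]. *)
pose s := (tperm (st 1) x * tperm t y)%g.
have sx : s (st 1) = x by rewrite permM tpermL tpermD // eq_sym.
have sy : s (st 2) = y by rewrite permM -/t tpermL.
rewrite -sx -[in X in collapse _ X]sy; apply: conj.
  by rewrite groupM // tperm_in.
by apply: G_gens; rewrite /gens gtn_eqF // !inE eqxx !orbT.
Qed.

Lemma ideal_maps_generated : ideal_maps (ord0 : Q) \subset G.
Proof.
apply/subsetP => f; rewrite !inE => /orP[/eqP f0|/imsetP[c c0 ->]].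
  apply: (@fixing_generated _ G ord0) => //; first exact: gens_id.
    by move=> x y x0 y0; have := tperm_in x0 y0; rewrite inE.
  exact: collapse_in.
have n10 : st 1 != ord0 by apply: st_neq0.
rewrite !inE in c0; have := tperm_in n10 c0; rewrite inE => tG.
suff -> : [ffun _ : Q => c] = comp_map (const_map (st 1)) (perm_map (tperm (st 1) c)).
  by apply: G_comp => //; apply: G_gens; rewrite /gens !inE eqxx orbT.
by apply/ffunP => x; rewrite !ffunE tpermL.
Qed.

End Generated.

End Witness.

(** * Realization over a given alphabet, and tightness *)

Lemma onto_letters (Sigma : finType) (T : eqType) (s : seq T) :
  s != [::] -> size s <= #|Sigma| ->
  exists delta : Sigma -> T, (forall a, delta a \in s) /\
    (forall t, t \in s -> exists a, delta a = t).
Proof.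
case: s => [//|t0 s0]; set s := t0 :: s0 => _ le_s.
(* Surplus letters all receive the default [t0], so they add no new map. *)
exists (fun a => nth t0 s (enum_rank a)); split=> [a|t ts].
  have [lt|ge] := ltnP (enum_rank a) (size s); first exact: mem_nth.
  by rewrite nth_default // mem_head.
have lt : index t s < #|Sigma| by apply: leq_trans le_s; rewrite index_mem.
by exists (enum_val (Ordinal lt)); rewrite enum_valK /= nth_index.
Qed.

Lemma ideal_maps_realized (Sigma : finType) k : min_alpha k.+2 <= #|Sigma| ->
  exists delta : Sigma -> {ffun 'I_k.+2 -> 'I_k.+2},
    transition_semigroup delta = ideal_maps ord0.
Proof.
rewrite -size_gens => /onto_letters[//|delta [delta_in delta_onto]].
exists delta; apply/eqP; rewrite eqEsubset; apply/andP; split.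
  apply/subsetP => f /transition_semigroupP[w w0 <-].
  have dI a : delta a \in ideal_maps ord0 by apply: gens_ideal.
  elim: w w0 => [//|a w IH] _; case: (eqVneq w [::]) => [->|/IH wI].
    suff -> : trans delta [:: a] = delta a by [].
    by apply/ffunP => x; rewrite ffunE.
  suff -> : trans delta (a :: w) = comp_map (delta a) (trans delta w).
    exact: ideal_maps_comp.
  by apply/ffunP => x; rewrite !ffunE.
apply: ideal_maps_generated => [f g /transition_semigroupP[u u0 <-]|f].
  move=> /transition_semigroupP[v v0 <-].
  apply/transition_semigroupP; exists (u ++ v); first by case: u u0.
  by apply/ffunP => x; rewrite !ffunE run_cat.
by case/delta_onto => a <-; apply: letter_in.
Qed.

Lemma tight_left_ideal (Sigma : finType) n : 0 < n -> min_alpha n <= #|Sigma| ->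
  exists L : lang Sigma, [/\ left_ideal L, kappa_eq L n & sigma_eq L (sbound n)].
Proof.
case: n => [//|[|k]] _ cS.
  have /card_gt0P[a _] : 0 < #|Sigma| by [].
  exists (fun _ => True); split.
  - by split=> [|w]; [exists [::] | split=> // _; exists [::], w].
  - by exists (fun _ => [::]); split=> [i j _|u]; [rewrite !ord1 | exists ord0].
  by exists (fun _ => [:: a]); split=> //; split=> [i j _|x _]; [rewrite !ord1 | exists ord0].
have [delta full] := ideal_maps_realized cS.
pose one : 'I_k.+2 := st k 1.
have one0 : one != ord0 by apply: st_neq0.
pose L : lang Sigma := fun w => run delta ord0 w = one.
have dfa : minimal_dfa L delta ord0 (fun q => q = one).
  split=> [//|q|p q pq].
    have [->|q0] := eqVneq q ord0; first by exists [::].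
    have [|w _ wE] := word_of full (f := const_map q).
      by apply/ideal_mapsP; right=> x; rewrite !ffunE.
    by exists w; rewrite wE ffunE.
  (* The map sending [x] to [one] and every other state to 0 fixes 0, so some word induces it and
     separates [x] from the rest. *)
  have sep x y : x != ord0 -> (forall w, run delta x w = one -> run delta y w = one) -> x = y.
    move=> x0 xy.
    have [|w _ wE] := fixing_word full (f := [ffun z => if z == x then one else ord0]).
      by rewrite ffunE eq_sym (negPf x0).
    have /xy : run delta x w = one by rewrite wE ffunE eqxx.
    rewrite wE ffunE; case: eqP => [->//|_ e].
    by rewrite -e eqxx in one0.
  have [p0|p0] := eqVneq p ord0; last by apply: sep => // w /pq.
  have [q0|q0] := eqVneq q ord0; first by rewrite p0.
  by apply/esym; apply: sep => // w /pq.
exists L; split; last 2 first.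
- exact: minimal_dfa_kappa dfa.
- by apply/(sigma_eqE dfa); rewrite full card_ideal_maps card_ord.
split; first by case: dfa => _ reach _; apply: reach.
move=> w; split=> [Lw|[u [v [-> Lv]]]]; first by exists [::], w.
(* A word of [L] moves the initial state, hence acts as a constant, and prepending [u] does not
   change where it leads. *)
rewrite /L run_cat; case: (run_ideal full v) => [e|->] //.
by rewrite -[one]Lv e eqxx in one0.
Qed.

Theorem theorem4 :
  (* upper bound *)
  (forall (Sigma : finType) (L : lang Sigma) (n : nat),
      0 < #|Sigma| -> 1 <= n -> kappa_eq L n ->
      left_ideal L \/ suffix_closed L ->
      exists m, sigma_eq L m /\ m <= sbound n) /\
  (* tightness, for each of the two types *)
  (forall (Sigma : finType) (n : nat),
      1 <= n -> min_alpha n <= #|Sigma| ->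
      (exists L : lang Sigma, left_ideal L /\ kappa_eq L n /\ sigma_eq L (sbound n)) /\
      (exists L : lang Sigma, suffix_closed L /\ kappa_eq L n /\ sigma_eq L (sbound n))) /\
  (* the alphabet sizes cannot be reduced *)
  (forall (Sigma : finType) (n : nat),
      1 <= n -> 0 < #|Sigma| < min_alpha n ->
      (forall L : lang Sigma, left_ideal L -> kappa_eq L n -> ~ sigma_eq L (sbound n)) /\
      (forall L : lang Sigma, suffix_closed L -> kappa_eq L n -> ~ sigma_eq L (sbound n))).
Proof.
split; [|split].
- move=> Sigma L n _ _ kL [lL|sL].
    by have [] := left_closed_bounds kL (left_ideal_closed lL).
  have [[m [sm mn]] _] :=
    left_closed_bounds (kappa_complement kL) (suffix_closed_complement sL).
  by exists m; split=> //; apply/sigma_complement.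
- move=> Sigma n n1 cS; have [L [lL kL sL]] := tight_left_ideal n1 cS.
  split; first by exists L.
  exists (complement L); split; last first.
    by split; [exact: kappa_complement | apply/sigma_complement].
  by move=> u v nuv Lv; apply: nuv; apply: left_ideal_closed.
move=> Sigma n n1 /andP[S0 Sn].
(* Since [min_alpha 1] is 1, no nonempty alphabet is smaller when [n = 1]. *)
have n2 : 1 < n by case: n n1 Sn => [|[|n]] // _; rewrite ltnNge S0.
split=> L tL kL sL; move: Sn; rewrite ltnNge => /negP; apply.
  by have [_] := left_closed_bounds kL (left_ideal_closed tL); apply.
have [_] := left_closed_bounds (kappa_complement kL) (suffix_closed_complement tL).
by apply=> //; apply/sigma_complement.
Qed.
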